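(* Let $X$ be a separable Banach space and let $(A(n))_{n\in\mathbb Z}$ be bounded linear operators on $X$. Suppose that there are positive constants $\kappa$, $\epsilon$ and $\beta$ such that the three pairs $(\ell^\infty_{1/\kappa e^{\epsilon\cdot},\lambda}(\mathbb Z),\ell^\infty_{1,\lambda}(\mathbb Z))$ for $\lambda=\beta$ and $\lambda=-\beta$, and $(\ell^\infty_{|1/\kappa e^{\epsilon\cdot},\beta|}(\mathbb Z),\ell^\infty_{|1,\beta|}(\mathbb Z))$, are properly admissible for the difference equation $x(n+1)=A(n)x(n)$, $n\in\mathbb Z$. Then this equation has a nonuniform exponential dichotomy on $\mathbb Z$ with bound $\tilde\kappa e^{\epsilon|n|}$ for some positive constant $\tilde\kappa$.
   Context: $|\cdot|$ is the norm of $X$ and $\|\cdot\|$ the operator norm. For constants $\kappa>0$, $\epsilon\ge0$ and $\lambda\in\mathbb R$, $\ell^\infty_{1/\kappa e^{\epsilon\cdot},\lambda}(\mathbb Z)$ is the Banach space of sequences $f=(f(n))_{n\in\mathbb Z}\subset X$ with finite norm $\sup_{n\in\mathbb Z}(\kappa e^{\epsilon|n|}e^{-\lambda n}|f(n)|)$, and $\ell^\infty_{|1/\kappa e^{\epsilon\cdot},\lambda|}(\mathbb Z)$ is the Banach space of those with finite norm $\sup_{n\in\mathbb Z}(\kappa e^{\epsilon|n|}e^{-\lambda|n|}|f(n)|)$. When $\kappa=1$ and $\epsilon=0$ these are written $\ell^\infty_{1,\lambda}(\mathbb Z)$ and $\ell^\infty_{|1,\lambda|}(\mathbb Z)$. A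 pair $(\mathcal Y,\mathcal Z)$ of such spaces is properly admissible for the equation $x(n+1)=A(n)x(n)$ if for each $f\in\mathcal Y$ there is a unique $x\in\mathcal Z$ with $x(n+1)=A(n)x(n)+f(n+1)$ for all $n\in\mathbb Z$. For $n\ge m$ let $U(n,m):=A(n-1)\cdots A(m)$ if $n>m$ and $U(m,m):=\mathrm{Id}$. The equation has a nonuniform exponential dichotomy on $\mathbb Z$ with bound $M(n)$ (here $M(n)=\tilde\kappa e^{\epsilon|n|}$) if there are projections $P(n)\in\mathcal L(X)$, $n\in\mathbb Z$, and a constant $\alpha>0$ such that $P(n)U(n,m)=U(n,m)P(m)$ for $n\ge m$; for $n\ge m$ the restriction $U(n,m)|_{\ker P(m)}:\ker P(m)\to\ker P(n)$ is an isomorphism, whose inverse is denoted $U(m,n)$; and $\|U(n,m)P(m)\|\le M(m)e^{-\alpha(n-m)}$ for $n\ge m$, $\|U(n,m)(\mathrm{Id}-P(m))\|\le M(m)e^{-\alpha(m-n)}$ for $n\le m$. *)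

(* Defs.v *)
From HB Require Import structures.
From mathcomp Require Import all_boot all_order all_algebra.
From mathcomp Require Import complex.
From mathcomp Require Import all_classical all_reals all_analysis.
Set Implicit Arguments.
Unset Strict Implicit.
Unset Printing Implicit Defensive.
Import Order.TTheory GRing.Theory Num.Theory.
Import numFieldNormedType.Exports.
Local Open Scope classical_set_scope.
Local Open Scope ring_scope.

(* A Banach space is a [completeNormedModType] over the real field [R] or over
   the complex field [R[i]]; both cases are treated at once. *)
Variant scalar_kind := RealScalars | ComplexScalars.

Definition scalars (R : realType) (k : scalar_kind) : numFieldType :=
  match k with
  | RealScalars => R : numFieldType
  | ComplexScalars => complex R : numFieldType
  end.

Definition scalar_re (R : realType) (k : scalar_kind) : scalars R k -> R :=
  match k return scalars R k -> R with
  | RealScalars => fun r => r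
  | ComplexScalars => fun z => complex.Re z
  end.

Section Dichotomy.
Variables (R : realType) (k : scalar_kind) (X : normedModType (scalars R k)).
Implicit Types (A : int -> {linear X -> X}) (n m : int) (M w : int -> R).

(* The library norm of [X] takes its values in the scalar field; they are
   nonnegative reals there, and [rnorm] is the same norm valued in [R]. *)
Definition rnorm (x : X) : R := scalar_re `|x|.

(* The supremum is taken in the extended reals, so an unbounded operator has
   norm [+oo]. *)
Definition opnorm (T : X -> X) : \bar R :=
  ereal_sup [set (rnorm (T x))%:E | x in [set x | rnorm x <= 1]].

Definition bounded_op (T : X -> X) : Prop := (opnorm T < +oo)%E.

Definition separable : Prop := exists D : set X, countable D /\ dense D.

Definition linfty w : set (int -> X) :=
  [set f | (ereal_sup (range (fun n => (w n * rnorm (f n))%:E)) < +oo)%E].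

Definition properly_admissible A (Y Z : set (int -> X)) : Prop :=
  forall f, Y f ->
    exists! x : int -> X,
      Z x /\ forall n, x (n + 1) = A n (x n) + f (n + 1).

Fixpoint steps A m (j : nat) (x : X) : X :=
  if j is i.+1 then A (m + i%:Z) (steps A m i x) else x.

(* [A (n - 1) \o ... \o A m] when [m <= n]; only used in that case. *)
Definition evol A n m : X -> X := steps A m `|n - m|%N.

Definition opker (T : X -> X) : set X := [set x | T x = 0].

(* For [n <= m], the inverse [ker (P m) -> ker (P n)] of the restriction of
   [evol A m n], extended arbitrarily outside [ker (P m)]. *)
Definition evol_back A (P : int -> {linear X -> X}) n m (x : X) : X :=
  xget 0 [set y | opker (P n) y /\ evol A m n y = x].

Definition nonuniform_exp_dichotomy A M : Prop :=
  exists (P : int -> {linear X -> X}) (alpha : R),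
    [/\ 0 < alpha,
        forall n, bounded_op (P n) /\ (forall x, P n (P n x) = P n x),
        forall n m x, m <= n -> P n (evol A n m x) = evol A n m (P m x),
        forall n m, m <= n ->
          set_bij (opker (P m)) (opker (P n)) (evol A n m) &
        (forall n m, m <= n ->
          (opnorm (fun x => evol A n m (P m x))
            <= (M m * expR (- alpha * (n - m)%:~R))%:E)%E)
        /\ (forall n m, n <= m ->
          (opnorm (fun x => evol_back A P n m (x - P m x)%R)
            <= (M m * expR (- alpha * (m - n)%:~R))%:E)%E)].

End Dichotomy.

Definition weight (R : realType) (kappa eps lam : R) (n : int) : R :=
  kappa * expR (eps * `|n|%:~R) * expR (- lam * n%:~R).

Definition weight_abs (R : realType) (kappa eps lam : R) (n : int) : R :=
  kappa * expR (eps * `|n|%:~R) * expR (- lam * `|n|%:~R).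

Arguments separable {R k} X.
Arguments linfty {R k} X w.

(* Main.v *)
Require Import Defs.
From HB Require Import structures.
From mathcomp Require Import all_boot all_order all_algebra.
From mathcomp Require Import complex ring lra zify.
From mathcomp Require Import all_classical all_reals all_analysis.
Import Order.TTheory GRing.Theory Num.Theory.
Import numFieldNormedType.Exports.
Local Open Scope classical_set_scope.
Local Open Scope ring_scope.

Set Implicit Arguments.
Unset Strict Implicit.
Unset Printing Implicit Defensive.

(** The dichotomy is read off a Green function.  Write [delta m v] for the
    sequence equal to [v] at time [m] and to zero elsewhere, and suppose that
    [x (n + 1) = A n (x n) + delta m v (n + 1)] has exactly one bounded solution
    [green m v], and that it decays like [expR (- beta * |n - m|)].  Then
    [P m v := green m v m] is the stable projection: from time [m] on,
    [green m v] is the forward orbit of [P m v], which decays; before [m] it is,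
    up to sign, a decaying backward orbit of [v - P m v].  Uniqueness alone
    yields the algebra.  The shift identity
    [green m v - delta m v = green (m + 1) (A m v)] ([green_shift]) contains the
    commutation of [P] with the evolution and the injectivity of the evolution
    on kernels, and the fact that the past of [green m v] lies in the kernels of
    [P] ([green_before]) gives idempotence and surjectivity on kernels.  The two
    exponential estimates are the decay of [green] ([green_dichotomy]).

    The Green function comes from the three admissible pairs.  Admissibility
    says that every forcing term has a response, and the crucial point is that
    the size of the response to [delta m v] is controlled by a constant
    independent of [m] and [v].  This is a closed graph theorem, proved here for
    families of balls rather than for norms ([closed_graph_gauge]), so that it
    applies to weighted spaces of sequences as sets of functions
    ([admissible_bounded]).  For the pair of exponent [lam] it gives a
    response bounded by a multiple of [expR (eps * |m|) * expR (lam * (n - m))]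
    ([admissible_delta]).  The responses for [lam = beta] and [lam = - beta] both
    belong to the space of growth at most [expR (beta * |n|)], where the third
    pair ensures uniqueness; hence they coincide, and the better of the two
    bounds holds on each side of [m] ([admissible_green]). *)

(** * The real-valued norm *)

Section RealNorm.
Variables (R : realType) (k : scalar_kind).

(** The inclusion of the reals in the scalars, a right inverse of [scalar_re]
    that moves estimates between the library norm and [rnorm]. *)
Definition real_scalar : R -> scalars R k :=
  match k return R -> scalars R k with
  | RealScalars => fun r => r
  | ComplexScalars => fun r => real_complex R r
  end.

Lemma real_scalarK r : scalar_re (real_scalar r) = r.
Proof. by rewrite /real_scalar /scalar_re; case: k. Qed.

Lemma scalar_reK (z : scalars R k) : 0 <= z -> real_scalar (scalar_re z) = z.
Proof.
rewrite /real_scalar /scalar_re; case: k z => //= z z0.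
by apply: RRe_real; exact: ger0_real.
Qed.

Lemma real_scalarM r s : real_scalar (r * s) = real_scalar r * real_scalar s.
Proof. by rewrite /real_scalar; case: k => //; rewrite rmorphM. Qed.

Lemma real_scalarD r s : real_scalar (r + s) = real_scalar r + real_scalar s.
Proof. by rewrite /real_scalar; case: k => //; rewrite rmorphD. Qed.

Lemma real_scalar0 : real_scalar 0 = 0.
Proof. by rewrite /real_scalar; case: k => //; rewrite rmorph0. Qed.

Lemma real_scalar1 : real_scalar 1 = 1.
Proof. by rewrite /real_scalar; case: k => //; rewrite rmorph1. Qed.

Lemma real_scalar_le r s : (real_scalar r <= real_scalar s) = (r <= s).
Proof. by rewrite /real_scalar; case: k => //; rewrite lecR. Qed.

Lemma real_scalar_lt r s : (real_scalar r < real_scalar s) = (r < s).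
Proof. by rewrite /real_scalar; case: k => //; rewrite ltcR. Qed.

Lemma real_scalarV r : real_scalar r^-1 = (real_scalar r)^-1.
Proof. by rewrite /real_scalar; case: k => //; rewrite fmorphV. Qed.

Variable X : normedModType (scalars R k).
Implicit Types x y : X.

Lemma rnormE x : `|x| = real_scalar (rnorm x).
Proof. by rewrite /rnorm scalar_reK. Qed.

Lemma rnorm_ge0 x : 0 <= rnorm x.
Proof. by rewrite -real_scalar_le real_scalar0 -rnormE. Qed.

Lemma rnormD x y : rnorm (x + y) <= rnorm x + rnorm y.
Proof. by rewrite -real_scalar_le real_scalarD -!rnormE ler_normD. Qed.

Lemma rnormN x : rnorm (- x) = rnorm x.
Proof. by rewrite /rnorm normrN. Qed.

Lemma rnormB x y : rnorm (x - y) <= rnorm x + rnorm y.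
Proof. by rewrite (le_trans (rnormD _ _)) ?rnormN. Qed.

Lemma rnorm0 : rnorm (0 : X) = 0.
Proof. by rewrite /rnorm normr0 -real_scalar0 real_scalarK. Qed.

Lemma rnorm_le0 x : rnorm x <= 0 -> x = 0.
Proof.
move=> x0; apply/eqP; rewrite -normr_eq0 rnormE.
by rewrite (_ : rnorm x = 0) ?real_scalar0//; apply/le_anti; rewrite x0 rnorm_ge0.
Qed.

Lemma rnormZ (a : scalars R k) x : rnorm (a *: x) = scalar_re `|a| * rnorm x.
Proof.
by rewrite /rnorm normrZ rnormE -(scalar_reK (normr_ge0 a)) -real_scalarM !real_scalarK.
Qed.

Lemma rnormZ_real (t : R) x : 0 <= t -> rnorm (real_scalar t *: x) = t * rnorm x.
Proof.
move=> t0; rewrite rnormZ ger0_norm ?real_scalarK//.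
by rewrite -real_scalar0 real_scalar_le.
Qed.

Lemma rnorm_half x : rnorm (2^-1 *: x) = rnorm x / 2.
Proof.
have -> : 2^-1 = real_scalar (2^-1 : R).
  by rewrite real_scalarV (_ : 2 = 1 + 1)// real_scalarD real_scalar1.
by rewrite rnormZ_real ?invr_ge0// mulrC.
Qed.

End RealNorm.

(** * Geometric convergence *)

Lemma geometric_small (R : realType) (c e : R) :
  0 < e -> exists n, c / 2 ^+ n < e.
Proof.
move=> e0; have [n ceN] : exists n, c / e < n%:R.
  exists (Num.truncn `|c / e|).+1.
  by rewrite (le_lt_trans (ler_norm _))// truncnS_gt.
exists n; rewrite ltr_pdivrMr ?exprn_gt0//.
rewrite mulrC -ltr_pdivrMr// (lt_trans ceN)// -natrX ltr_nat.
exact: ltn_expl.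
Qed.

Lemma geometric_le0 (R : realType) (a c : R) :
  (forall n, a <= c / 2 ^+ n) -> a <= 0.
Proof.
move=> ac; rewrite leNgt; apply/negP => /(geometric_small c)[n].
by rewrite ltNge ac.
Qed.

Lemma halving_le (R : realFieldType) (r : nat -> R) :
  (forall n, r n.+1 <= r n / 2) -> forall n, r n <= r 0 / 2 ^+ n.
Proof.
move=> rS; elim=> [|n IHn]; first by rewrite expr0 divr1.
rewrite (le_trans (rS n))// exprSr invfM mulrA ler_wpM2r// invr_ge0; lra.
Qed.

(** The bound [r n] on a step halves each time, so a tail of steps sums to at
    most twice its first bound. *)
Lemma geometric_cvg (R : realType) (k : scalar_kind)
    (X : completeNormedModType (scalars R k)) (u : nat -> X) (r : nat -> R) :
    (forall n, rnorm (u n.+1 - u n) <= r n) ->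
    (forall n, r n.+1 <= r n / 2) ->
  exists l, forall n, rnorm (l - u n) <= 2 * r n.
Proof.
move=> ur rS.
have r0 n : 0 <= r n by exact: le_trans (rnorm_ge0 _) (ur n).
have tail j n : rnorm (u (n + j)%N - u n) <= 2 * r n.
  elim: j n => [n|j IHj n].
    by rewrite addn0 subrr rnorm0 mulr_ge0.
  rewrite -(subrK (u n.+1) (u _)) -addrA (le_trans (rnormD _ _))//.
  have := IHj n.+1; rewrite addSnnS => h1; have := ur n; have := rS n; lra.
have near_tail (e : R) : 0 < e ->
    exists n, forall m, (n <= m)%N -> rnorm (u m - u n) < e.
  move=> e0; have [n ne] := geometric_small (2 * r 0) e0.
  exists n => m nm; rewrite -(subnKC nm) (le_lt_trans (tail _ _))//.
  by rewrite (le_lt_trans _ ne)// -mulrA ler_pM2l// halving_le.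
have : cauchy (u @ \oo).
  apply: cauchy_exP => e e0.
  have e0' : 0 < scalar_re e.
    by rewrite -(real_scalar_lt k) real_scalar0 scalar_reK// ltW.
  have [n ne] := near_tail _ e0'.
  exists (u n); exists n => // m /= nm.
  rewrite -ball_normE /ball_ /= distrC rnormE -(scalar_reK (ltW e0)) real_scalar_lt.
  exact: ne.
move=> /cauchy_cvgP/cvg_ex[l ul]; exists l => n.
apply/ler_addgt0Pl => e e0.
have e0' : 0 < real_scalar k e by rewrite -real_scalar0 real_scalar_lt.
move/cvgrPdist_lt : ul => /(_ _ e0')[m _ /(_ (n + m)%N)].
rewrite /= leq_addl => /(_ isT); rewrite rnormE real_scalar_lt => lt_e.
rewrite -(subrK (u (n + m)%N) l) -addrA (le_trans (rnormD _ _))// lerD// ltW//.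
Qed.

(** * Suprema and operator bounds *)

Lemma ereal_sup_lty (R : realType) (I : Type) (D : set I) (g : I -> R) :
  (ereal_sup [set (g i)%:E | i in D] < +oo)%E <->
  exists C, forall i, D i -> g i <= C.
Proof.
split=> [|[C gC]]; last first.
  apply: (@le_lt_trans _ _ C%:E); last by rewrite ltry.
  by apply: ge_ereal_sup => _ [i Di <-]; rewrite lee_fin gC.
case E: (ereal_sup _) => [C||]// _.
  by exists C => i Di; rewrite -lee_fin -E; apply: ereal_sup_ubound; exists i.
exists 0 => i Di; suff : ((g i)%:E <= -oo)%E by rewrite leeNy_eq.
by rewrite -E; apply: ereal_sup_ubound; exists i.
Qed.

Section Operators.
Variables (R : realType) (k : scalar_kind) (X : normedModType (scalars R k)).

Lemma opnorm_le (T : X -> X) C : 0 <= C ->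
  (forall x, rnorm (T x) <= C * rnorm x) -> (opnorm T <= C%:E)%E.
Proof.
move=> C0 TC; apply: ge_ereal_sup => _ [x /= x1 <-]; rewrite lee_fin.
by rewrite (le_trans (TC x))// ler_piMr.
Qed.

Lemma bounded_opP (T : {linear X -> X}) : bounded_op T <->
  exists2 C, 0 <= C & forall x, rnorm (T x) <= C * rnorm x.
Proof.
split=> [/ereal_sup_lty[C TC]|[C C0 TC]]; last first.
  exact: le_lt_trans (opnorm_le C0 TC) (ltry _).
exists C => [|x].
  by rewrite (le_trans (rnorm_ge0 (T 0)))// TC//= rnorm0.
have [x0|x0] := leP (rnorm x) 0.
  by rewrite (rnorm_le0 x0) linear0 rnorm0 mulr0.
have xi0 : 0 <= (rnorm x)^-1 by rewrite invr_ge0 ltW.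
rewrite -ler_pdivrMr// mulrC -rnormZ_real// -linearZ TC//= rnormZ_real//.
by rewrite mulVf// gt_eqF.
Qed.

End Operators.

(** * A closed graph theorem for families of balls *)

Section ClosedGraph.
Variables (R : realType) (K : numFieldType) (V : lmodType K).

(** [B r] plays the role of the closed ball of radius [r] of a seminorm that
    may be infinite at some vectors; halving is the only homogeneity that the
    Baire argument uses. *)
Record gauge (B : R -> set V) : Prop := Gauge {
  gauge0 : forall r, 0 <= r -> B r 0;
  gaugeB : forall r s u v, B r u -> B s v -> B (r + s) (u - v);
  gauge_half : forall r u, B r u -> B (r / 2) (2^-1 *: u) }.

Section GaugeTheory.
Variables (B : R -> set V) (gB : gauge B).

Lemma gauge_le r s u : r <= s -> B r u -> B s u.
Proof.
rewrite -subr_ge0 => rs Bu; rewrite -[u]subr0 -[s](subrKC r).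
exact: gaugeB (gauge0 gB rs).
Qed.

Lemma gaugeN r u : B r u -> B r (- u).
Proof. by move=> Bu; rewrite -sub0r -[r]add0r; apply: gaugeB => //; exact: gauge0. Qed.

Lemma gaugeD r s u v : B r u -> B s v -> B (r + s) (u + v).
Proof. by move=> Bu Bv; rewrite -[v]opprK; apply: gaugeB => //; exact: gaugeN. Qed.

End GaugeTheory.

(** Think of [B] as the balls of a Banach space and of [E a] as the set of [u]
    whose image under a linear map has norm at most [a]: the last premise says
    that the map is defined everywhere, the one before it that the map is
    closed, in the form of countable subadditivity along geometric series.  By a
    Baire argument some [E N] is dense in a ball; translating and halving, every
    [E (a / 2 ^+ i)] is dense in the ball of radius [r / 2 ^+ i] about zero.  A
    vector of the first ball is then the sum of successive approximations taken
    from these sets, so the map is bounded on it. *)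
Lemma closed_graph_gauge (B E : R -> set V) : gauge B -> gauge E ->
    (forall (u : nat -> V) (r : nat -> R), (forall n, B (r n) (u n.+1 - u n)) ->
      (forall n, r n.+1 <= r n / 2) -> exists s, forall n, B (2 * r n) (s - u n)) ->
    (forall h (s : nat -> V) a b, s 0%N = 0 ->
      (forall n, E (a / 2 ^+ n) (s n.+1 - s n)) ->
      (forall n, B (b / 2 ^+ n) (h - s n)) -> E (2 * a) h) ->
    (forall r u, B r u -> exists a, E a u) ->
  exists r a, [/\ 0 < r, 0 < a & forall u, B r u -> E a u].
Proof.
move=> gB gE Bcomplete Eclosed total.
pose dense N u0 r0 := forall u, B r0 (u - u0) -> forall d, 0 < d ->
  exists2 e, E N%:R e & B d (u - e).
have [N [u0 [r0 [r0_gt0 Nu0r0]]]] :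
    exists N u0 r0, 0 < r0 /\ dense N u0 r0.
  apply: contrapT => nowhere.
  (* Nested balls: the N-th one stays away from [E N%:R]; the factor 2 matches
     the distance from the centres to the limit. *)
  have avoid N (p : V * R) : exists q : V * R, 0 < p.2 ->
      [/\ 0 < q.2, q.2 <= p.2 / 2, B p.2 (q.1 - p.1) &
        forall e, E N%:R e -> ~ B (2 * q.2) (q.1 - e)].
    have [p0|p0] := ltP 0 p.2; last by exists p; rewrite ltNge p0.
    apply: contrapT => noq; apply: nowhere.
    exists N, p.1, p.2; split=> // u Bu d d0; apply: contrapT => noe.
    apply: noq; exists (u, Num.min (p.2 / 2) (d / 2)) => _ /=; split=> //.
    - by rewrite lt_min !divr_gt0.
    - by rewrite ge_min lexx.
    move=> e Ee Be; apply: noe; exists e => //; apply: (gauge_le gB) Be.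
    have : Num.min (p.2 / 2) (d / 2) <= d / 2 by rewrite ge_min lexx orbT.
    lra.
  have [next nextP] := choice (fun Np : nat * (V * R) => avoid Np.1 Np.2).
  pose st := fix st n : V * R := if n is m.+1 then next (m, st m) else (0, 1).
  have st0 n : 0 < (st n).2.
    by elim: n => [|n IHn] //=; have [] := nextP (n, st n) IHn.
  have [s sP] : exists s, forall n, B (2 * (st n).2) (s - (st n).1).
    by apply: Bcomplete => n; have [] := nextP (n, st n) (st0 n).
  have [a Ea] : exists a, E a s.
    by apply: (total (2 * 1)); rewrite -[s]subr0; exact: (sP 0%N).
  pose N := (Num.truncn `|a|).+1.
  have EN : E N%:R s.
    by apply: (gauge_le gE) Ea; rewrite (le_trans (ler_norm _))// ltW// truncnS_gt.
  have [_ _ _ /(_ _ EN)] := nextP (N, st N) (st0 N); apply.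
  by rewrite -opprB; apply: gaugeN => //; exact: (sP N.+1).
(* A difference of two elements of [E N] approximates a difference of two
   points of the ball, hence any vector of the ball about zero. *)
pose a : R := 2 * N%:R.
have a0 : 0 <= a by rewrite mulr_ge0.
have approx0 h d : B r0 h -> 0 < d -> exists2 e, E a e & B d (h - e).
  move=> Bh d0; have d20 : 0 < d / 2 by rewrite divr_gt0.
  have [|e1 Ee1 Be1] := Nu0r0 u0 _ _ d20.
    by rewrite subrr; apply: gauge0 => //; exact: ltW.
  have [|e2 Ee2 Be2] := Nu0r0 (u0 + h) _ _ d20; first by rewrite addrAC subrr add0r.
  exists (e2 - e1).
    by rewrite /a mulr_natl mulr2n; exact: gaugeB.
  rewrite (_ : h - _ = (u0 + h - e2) - (u0 - e1)).
    by rewrite [d](splitr); exact: gaugeB.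
  by rewrite !opprB [RHS]addrC -(addrA u0) [RHS]addrA subrK addrCA.
have approx i h d : B (r0 / 2 ^+ i) h -> 0 < d ->
    exists2 e, E (a / 2 ^+ i) e & B d (h - e).
  elim: i h d => [|i IHi] h d.
    by rewrite expr0 !divr1; exact: approx0.
  move=> Bh d0; have dbl : B (r0 / 2 ^+ i) (h + h).
    have -> : r0 / 2 ^+ i = r0 / 2 ^+ i.+1 + r0 / 2 ^+ i.+1.
      by rewrite exprSr; field; rewrite expf_neq0.
    exact: gaugeD.
  have [||e Ee Be] := IHi (h + h) (d + d) => //; first by rewrite addr_gt0.
  exists (2^-1 *: e).
    by rewrite exprSr invfM mulrA; exact: gauge_half.
  have -> : d = (d + d) / 2 by field.
  have -> : h - 2^-1 *: e = 2^-1 *: (h + h - e).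
    by rewrite scalerBr -mulr2n -[h *+ 2]scaler_nat scalerA mulVf ?scale1r// pnatr_eq0.
  exact: gauge_half.
exists r0, (2 * (a + 1)); split=> //; first by lra.
move=> h Bh.
have stepP (ih : nat * V) : exists e, B (r0 / 2 ^+ ih.1) ih.2 ->
    E (a / 2 ^+ ih.1) e /\ B (r0 / 2 ^+ ih.1.+1) (ih.2 - e).
  have [Bih|nB] := pselect (B (r0 / 2 ^+ ih.1) ih.2); last by exists 0.
  have [|e Ee Be] := approx _ _ (r0 / 2 ^+ ih.1.+1) Bih.
    by rewrite divr_gt0 ?exprn_gt0.
  by exists e.
have [e eP] := choice stepP.
(* [res n] is what remains of [h] after [n] approximations. *)
pose res := fix res n := if n is m.+1 then res m - e (m, res m) else h.
have Bres n : B (r0 / 2 ^+ n) (res n).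
  elim: n => [|n IHn] /=; first by rewrite expr0 divr1.
  by have [] := eP (n, res n) IHn.
apply: (gauge_le gE (r := 2 * a)); first by lra.
apply: (Eclosed _ (fun n => h - res n) _ r0) => [|n|n] /=.
- by rewrite subrr.
- rewrite (_ : _ - _ = e (n, res n)); last first.
    by rewrite opprB addrA addrAC [_ + e _]addrC -addrA subrr addr0.
  by have [] := eP (n, res n) (Bres n).
- by rewrite subKr.
Qed.

End ClosedGraph.

(** * Responses to forcing terms *)

Section WeightedSequences.
Variables (R : realType) (k : scalar_kind).

Definition wball (X : normedModType (scalars R k)) (w : int -> R) (r : R) :
    set (int -> X) :=
  [set f | forall n, w n * rnorm (f n) <= r].

Lemma linftyP (X : normedModType (scalars R k)) (w : int -> R) f :
  linfty X w f <-> exists r, wball w r f.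
Proof.
rewrite /linfty /= ereal_sup_lty; split=> -[r fr]; exists r => n //.
exact: fr.
Qed.

Lemma gauge_wball (X : normedModType (scalars R k)) (w : int -> R) :
  (forall n, 0 <= w n) -> gauge (@wball X w).
Proof.
move=> w0; split=> [r r0 n|r s f g fr gs n|r f fr n].
- by rewrite rnorm0 mulr0.
- by rewrite (le_trans (ler_wpM2l _ (rnormB _ _)))// mulrDr lerD.
- by rewrite rnorm_half mulrA ler_pM2r ?invr_gt0// fr.
Qed.

Lemma wball_complete (X : completeNormedModType (scalars R k)) (w : int -> R)
    (u : nat -> int -> X) (r : nat -> R) : (forall n, 0 < w n) ->
    (forall n, wball w (r n) (u n.+1 - u n)) -> (forall n, r n.+1 <= r n / 2) ->
  exists s, forall n, wball w (2 * r n) (s - u n).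
Proof.
move=> w0 ur rS.
have lim j : exists l, forall n, rnorm (l - u n j) <= 2 * (r n / w j).
  apply: geometric_cvg => n.
    by rewrite ler_pdivlMr// mulrC; exact: ur.
  by rewrite mulrAC ler_pM2r ?invr_gt0.
have [s sP] := choice lim.
exists s => n j; rewrite mulrC -ler_pdivlMr// -mulrA; exact: sP.
Qed.

End WeightedSequences.

Section Admissibility.
Variables (R : realType) (k : scalar_kind) (X : completeNormedModType (scalars R k)).
Variable A : int -> {linear X -> X}.
Implicit Types (f x : int -> X) (w z : int -> R).

Definition solves f x : Prop := forall n, x (n + 1) = A n (x n) + f (n + 1).

Lemma solvesB f g x y : solves f x -> solves g y -> solves (f - g) (x - y).
Proof. by move=> sx sy n; rewrite !fctE sx sy linearB opprD addrACA. Qed.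

Lemma solvesZ c f x : solves f x -> solves (c *: f) (c *: x).
Proof. by move=> sx n; rewrite !fctE sx linearZ scalerDr. Qed.

Lemma solves0 : solves 0 0.
Proof. by move=> n; rewrite -[RHS]/(A n 0 + 0) linear0 addr0. Qed.

(** The preimage of a ball under the solution operator, stated without choosing
    a solution. *)
Definition response z (a : R) : set (int -> X) :=
  [set f | exists2 x, solves f x & wball z a x].

Lemma gauge_response z : (forall n, 0 <= z n) -> gauge (response z).
Proof.
move=> z0; have gz := gauge_wball X z0.
split=> [r r0|r s f g [x sx xr] [y sy ys]|r f [x sx xr]].
- by exists 0; [exact: solves0 | exact: (gauge0 gz)].
- by exists (x - y); [exact: solvesB | exact: (gaugeB gz)].
- by exists (2^-1 *: x); [exact: solvesZ | exact: (gauge_half gz)].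
Qed.

Hypothesis bounded_A : forall n, bounded_op (A n).

(** The solution operator is closed: responses to the terms of a series sum up
    to a sequence that is a response to the sum, since each [A n] is continuous
    and both sums converge at each time. *)
Lemma response_closed w z (h : int -> X) (s : nat -> int -> X) (a b : R) :
    (forall n, 0 < w n) -> (forall n, 0 < z n) -> s 0%N = 0 ->
    (forall n, response z (a / 2 ^+ n) (s n.+1 - s n)) ->
    (forall n, wball w (b / 2 ^+ n) (h - s n)) ->
  response z (2 * a) h.
Proof.
move=> w0 z0 s0 sE sB.
have [x xP] := choice (fun n => (exists2P _ _).1 (sE n)).
pose y n : int -> X := \sum_(i < n) x i.
have ysol n : solves (s n) (y n).
  elim: n => [|n IHn]; first by rewrite s0 /y big_ord0; exact: solves0.
  rewrite /y big_ord_recr /= -/(y n) -(subrK (s n) (s n.+1)) addrC.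
  by move=> j; rewrite !fctE IHn (xP n).1 linearD addrACA.
have [||l lP] := @wball_complete _ _ X z y (fun n => a / 2 ^+ n) z0.
- by move=> n; rewrite /y big_ord_recr /= addrAC subrr add0r; exact: (xP n).2.
- by move=> n; rewrite exprSr invfM mulrA.
exists l; last first.
  by have := lP 0%N; rewrite /y big_ord0 subr0 expr0 divr1.
move=> j; apply/eqP; rewrite -subr_eq0; apply/eqP/rnorm_le0.
have [C C0 AC] := (bounded_opP (A j)).1 (bounded_A j).
apply: (@geometric_le0 _ _ (2 * a / z (j + 1) + C * (2 * a / z j) + b / w (j + 1))).
move=> n.
have -> : l (j + 1) - (A j (l j) + h (j + 1)) =
    (l - y n) (j + 1) - A j ((l - y n) j) - (h - s n) (j + 1).
  rewrite !fctE ysol linearB -[RHS]addrA -opprD addrACA -[- _ - s n _]opprD.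
  by rewrite -[RHS]addrA -opprD subrKC.
have bnd v c d i : (forall n, 0 < v n) -> wball v (c / 2 ^+ n) d ->
    rnorm (d i : X) <= c / v i / 2 ^+ n.
  by move=> v0 vd; rewrite mulrAC ler_pdivlMr// mulrC; exact: vd.
rewrite (mulrDl _ (b / _)) (mulrDl (2 * a / _)) (le_trans (rnormB _ _))// lerD//;
  last exact: (bnd w _ (h - s n)).
rewrite (le_trans (rnormB _ _))// lerD//.
  by apply: (bnd z _ (l - y n)) => //; rewrite -mulrA; exact: lP.
rewrite (le_trans (AC _))// -(mulrA C) ler_wpM2l//.
by apply: (bnd z _ (l - y n)) => //; rewrite -mulrA; exact: lP.
Qed.

(** Existence of responses is enough for a uniform bound: the closed graph
    theorem gives it on one ball, and rescaling extends it to the others. *)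
Lemma admissible_bounded w z :
    (forall n, 0 < w n) -> (forall n, 0 < z n) ->
    (forall f, linfty X w f -> exists2 x, solves f x & linfty X z x) ->
  exists2 C, 0 < C & forall f r, 0 < r -> wball w r f -> response z (C * r) f.
Proof.
move=> w0 z0 adm.
have gw : gauge (@wball R k X w) by apply: gauge_wball => n; exact: ltW.
have gz : gauge (response z) by apply: gauge_response => n; exact: ltW.
have [|||r0 [a [r00 a0 aP]]] := closed_graph_gauge gw gz.
- by move=> u r; exact: wball_complete.
- by move=> h s a b; exact: response_closed.
- move=> r f fr; have [|x sx /linftyP[a xa]] := adm f; last by exists a, x.
  by apply/linftyP; exists r.
exists (a / r0) => [|f r r_gt0 fr]; first by rewrite divr_gt0.
have scal_wball v c d g : 0 < c -> wball v d g ->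
    @wball R k X v (c * d) (real_scalar k c *: g).
  by move=> c0 gd n; rewrite fctE (rnormZ_real _ (ltW c0)) mulrCA ler_pM2l// gd.
have r0r : 0 < r0 / r by rewrite divr_gt0.
have rr0 : 0 < r / r0 by rewrite divr_gt0.
have [|x sx xa] := aP (real_scalar k (r0 / r) *: f).
  by have := scal_wball _ _ _ _ r0r fr; rewrite divfK ?gt_eqF.
exists (real_scalar k (r / r0) *: x); last first.
  by rewrite (_ : a / r0 * r = r / r0 * a); [exact: scal_wball | ring].
suff -> : f = real_scalar k (r / r0) *: (real_scalar k (r0 / r) *: f).
  exact: solvesZ.
rewrite scalerA -real_scalarM (_ : r / r0 * (r0 / r) = 1) ?real_scalar1 ?scale1r//.
by field; rewrite !gt_eqF.
Qed.

End Admissibility.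

(** * From the Green function to the dichotomy *)

Section Delta.
Variables (R : realType) (k : scalar_kind) (X : normedModType (scalars R k)).

Definition delta (m : int) (v : X) : int -> X := fun n => if n == m then v else 0.

Definition seq_bounded (x : int -> X) : Prop := exists C, forall n, rnorm (x n) <= C.

Lemma seq_boundedB x y : seq_bounded x -> seq_bounded y -> seq_bounded (x - y).
Proof.
move=> [C xC] [D yD]; exists (C + D) => n.
by rewrite (le_trans (rnormB _ _))// lerD.
Qed.

Lemma seq_boundedZ a x : seq_bounded x -> seq_bounded (a *: x).
Proof.
move=> [C xC]; exists (scalar_re `|a| * C) => n; rewrite rnormZ ler_wpM2l//.
by rewrite -(real_scalar_le k) real_scalar0 scalar_reK.
Qed.

Lemma seq_boundedD x y : seq_bounded x -> seq_bounded y -> seq_bounded (x + y).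
Proof.
move=> [C xC] [D yD]; exists (C + D) => n.
by rewrite (le_trans (rnormD _ _))// lerD.
Qed.

Lemma delta_bounded m v : seq_bounded (delta m v).
Proof.
exists (rnorm v) => n; rewrite /delta; case: eqP => // _.
by rewrite rnorm0 rnorm_ge0.
Qed.

End Delta.

Section Dichotomy.
Variables (R : realType) (k : scalar_kind) (X : completeNormedModType (scalars R k)).
Variable A : int -> {linear X -> X}.

Lemma addrzS (m : int) (j : nat) : m + j.+1%:Z = m + j%:Z + 1.
Proof. by rewrite intS [1 + _]addrC addrA. Qed.

Lemma stepsS m j x : steps A m j.+1 x = A (m + j%:Z) (steps A m j x).
Proof. by []. Qed.

Lemma solves_steps f x m j : solves A f x ->
    (forall i, (i < j)%N -> f (m + i.+1%:Z) = 0) ->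
  x (m + j%:Z) = steps A m j (x m).
Proof.
move=> sx; elim: j => [|j IHj] f0 /=; first by rewrite addr0.
rewrite -IHj => [|i ij]; last by apply: f0; exact: ltnW.
by have := f0 j (ltnSn j); rewrite addrzS sx => ->; rewrite addr0.
Qed.

(** Cutting the past of a solution off at time [n] costs a single impulse
    [x n] at that time. *)
Lemma solves_truncate f x n : solves A f x ->
  solves A (fun j => if j == n then x n else if n < j then f j else 0)
    (fun j => if n <= j then x j else 0).
Proof.
move=> sx j; have [nj|jn] := leP n j.
  have nj1 : n < j + 1 by lia.
  by rewrite (ltW nj1) gt_eqF// nj1 sx.
have [jSn|] := eqVneq (j + 1) n.
  by rewrite -jSn lexx linear0 add0r.
move=> /eqP neq; have jSn : j + 1 < n by lia.
by rewrite leNgt jSn ltNge (ltW jSn) linear0 addr0.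
Qed.

Variables (beta : R) (N : int -> R).
Hypotheses (beta_gt0 : 0 < beta) (N_ge0 : forall m, 0 <= N m).
Hypothesis bounded_unique : forall x, solves A 0 x -> seq_bounded x -> x = 0.
Hypothesis green_exists : forall m v, exists2 x, solves A (delta m v) x &
  forall n, rnorm (x n) <= N m * expR (- beta * `|n - m|%:~R) * rnorm v.

Let green (m : int) (v : X) : int -> X := s2val (cid2 (green_exists m v)).

Let green_solves m v : solves A (delta m v) (green m v).
Proof. exact: s2valP. Qed.

Let green_le m v n :
  rnorm (green m v n) <= N m * expR (- beta * `|n - m|%:~R) * rnorm v.
Proof. exact: (s2valP' (cid2 (green_exists m v))). Qed.

Let green_bounded m v : seq_bounded (green m v).
Proof.
exists (N m * rnorm v) => n; rewrite (le_trans (green_le _ _ _))//.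
rewrite ler_wpM2r ?rnorm_ge0// ler_piMr// -expR0 ler_expR.
by rewrite mulNr oppr_le0 mulr_ge0 ?ler0z// ltW.
Qed.

Let green_unique m v x : solves A (delta m v) x -> seq_bounded x -> x = green m v.
Proof.
move=> sx bx; apply/eqP; rewrite -subr_eq0; apply/eqP/bounded_unique.
  by rewrite -[0](subrr (delta m v)); exact: solvesB.
exact: seq_boundedB.
Qed.

Let proj_fun m v := green m v m.

Let proj_fun_linear m : linear (proj_fun m).
Proof.
move=> a u v; rewrite /proj_fun -(@green_unique _ _ (a *: green m u + green m v))//.
  move=> n; rewrite !fctE !green_solves linearP scalerDr addrACA.
  by congr (_ + _); rewrite /delta; case: eqP => // _; rewrite scaler0 addr0.
by apply: seq_boundedD => //; exact: seq_boundedZ.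
Qed.

Let P m : {linear X -> X} :=
  HB.pack (proj_fun m) (GRing.isLinear.Build _ _ _ _ (proj_fun m) (proj_fun_linear m)).

Let PE m v : P m v = green m v m. Proof. by []. Qed.

(** Removing the impulse at time [m] postpones it: what arrives at time [m + 1]
    is its image under [A m]. *)
Let green_shift m v : green m v - delta m v = green (m + 1) (A m v).
Proof.
apply: green_unique; last by apply: seq_boundedB => //; exact: delta_bounded.
move=> n; rewrite !fctE green_solves addrK linearB -addrA.
rewrite /delta (inj_eq (addIr 1)); case: eqP => [->|_]; first by rewrite addNr addr0.
by rewrite linear0 oppr0 !addr0.
Qed.

(** The past of [green m v] is unstable: its restriction to the times from [n]
    on, minus [green m v] itself, is the bounded response to the impulse
    [green m v n], and this response vanishes at time [n]. *)
Let green_before n m v : n < m -> P n (green m v n) = 0.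
Proof.
move=> nm; pose x j := if n <= j then green m v j else 0.
have := @green_unique n (green m v n) (x - green m v).
rewrite PE => <-; first by rewrite !fctE /x lexx subrr.
  have -> : delta n (green m v n) =
      (fun j => if j == n then green m v n else if n < j then delta m v j else 0)
        - delta m v.
    apply/funext => j; rewrite !fctE /delta; have [->|jn] := eqVneq j n.
      by rewrite lt_eqF// subr0.
    have [_|] := ltP n j; first by rewrite subrr.
    by move=> /le_lt_trans/(_ nm)/lt_eqF->; rewrite subr0.
  by apply: solvesB => //; exact: solves_truncate.
apply: seq_boundedB => //; have [C xC] := green_bounded m v.
exists C => j; rewrite /x; case: ifP => // _.
by rewrite rnorm0 (le_trans _ (xC 0))// rnorm_ge0.
Qed.

(** The sequence on the left takes the value [v - P m v] at time [m] and minus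
    that of [green m v] elsewhere; being itself a Green function with a later
    impulse, it is an orbit of [A] up to time [m], inside the kernels of [P]. *)
Let unstable m v : delta m v - green m v = green (m + 1) (- A m v).
Proof.
rewrite -opprB green_shift; apply: green_unique; last first.
  by rewrite -sub0r; apply: seq_boundedB => //; exists 0 => n; rewrite rnorm0.
move=> n; rewrite !fctE green_solves linearN opprD; congr (_ + _).
by rewrite /delta; case: eqP => // _; rewrite oppr0.
Qed.

Let P_ker m v : P m (v - P m v) = 0.
Proof.
have -> : v - P m v = (delta m v - green m v) m by rewrite !fctE /delta eqxx.
by rewrite unstable green_before// ltzD1.
Qed.

Let P_step m v : P (m + 1) (A m v) = A m (P m v).
Proof.
rewrite PE -green_shift !fctE green_solves addrK//.
Qed.

(** Injectivity: if [A m] kills [v], then [green m v - delta m v] is the response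
    to no forcing, so its value [P m v - v] at time [m] is zero.  Surjectivity:
    for [w] in the kernel, [green (m + 1) w] vanishes at time [m + 1], so its
    value just before is sent to [- w]. *)
Let bij_step m : set_bij (opker (P m)) (opker (P (m + 1))) (A m).
Proof.
split=> [v Pv|v1 v2 /set_mem P1 /set_mem P2 A12|w Pw].
- by rewrite /opker/mkset P_step Pv linear0.
- have : green m (v1 - v2) - delta m (v1 - v2) = 0.
    rewrite green_shift linearB A12 subrr; apply/esym/green_unique.
      move=> n; rewrite /delta if_same; exact: solves0.
    by exists 0 => n; rewrite rnorm0.
  move/(congr1 (fun x => x m)); rewrite !fctE -PE linearB P1 P2 /delta eqxx.
  by rewrite subrr sub0r => /eqP; rewrite oppr_eq0 subr_eq0 => /eqP.
exists (- green (m + 1) w m).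
  by rewrite /opker/mkset linearN green_before ?oppr0// ltzD1.
have := green_solves (m + 1) w m; rewrite -PE Pw /delta eqxx linearN.
by move/esym/eqP; rewrite addr_eq0 => /eqP ->; rewrite opprK.
Qed.

Let evolE m j v : evol A (m + j%:Z) m v = steps A m j v.
Proof. by rewrite /evol addrAC subrr add0r. Qed.

Let P_evol n m v : m <= n -> P n (evol A n m v) = evol A n m (P m v).
Proof.
move=> mn; have -> : n = m + `|n - m|%N%:Z by lia.
rewrite !evolE; elim: `|n - m|%N => [|j IHj]; first by rewrite addr0.
by rewrite !stepsS -IHj addrzS P_step.
Qed.

Let bij_evol n m : m <= n -> set_bij (opker (P m)) (opker (P n)) (evol A n m).
Proof.
move=> mn; have -> : n = m + `|n - m|%N%:Z by lia.
rewrite (_ : evol _ _ _ = steps A m `|n - m|); last by apply/funext => v; exact: evolE.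
elim: `|n - m|%N => [|j IHj] /=; first by rewrite addr0; split=> // v Pv; exists v.
rewrite addrzS.
exact: (set_bij_comp IHj (bij_step _)).
Qed.

Let evol_backE n m v : n <= m ->
  evol_back A P n m (v - P m v) = (delta m v - green m v) n.
Proof.
move=> nm; set w := delta m v - green m v.
have Pw : P n (w n) = 0 by rewrite /w unstable green_before// ltzD1.
have wE : evol A m n (w n) = v - P m v.
  have := @solves_steps _ _ n `|m - n|%N (green_solves (m + 1) (- A m v)).
  rewrite -unstable -/w (_ : n + _ = m); last by lia.
  rewrite -/(evol A m n _) => <-; first by rewrite /w !fctE /delta eqxx.
  by move=> i im; rewrite /delta; case: eqP => //; lia.
apply: xget_unique => // y [Py yE].
by apply: (set_bij_inj (bij_evol nm)); rewrite ?inE// yE wE.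
Qed.

(** The summand [1] in the bound pays for [delta m v] in the unstable estimate,
    where the backward orbit is [delta m v - green m v]. *)
Theorem green_dichotomy (M : int -> R) :
  (forall m, N m + 1 <= M m) -> nonuniform_exp_dichotomy A M.
Proof.
move=> NM; exists P, beta.
have M_ge0 m : 0 <= M m by rewrite (le_trans _ (NM m))// addr_ge0.
split; first exact: beta_gt0.
- move=> n; split=> [|v]; last first.
    by apply/esym/eqP; rewrite -subr_eq0 -linearB P_ker.
  apply/bounded_opP; exists (N n) => // v.
  by rewrite (le_trans (green_le _ _ _))// subrr normr0 mulr0 expR0 mulr1.
- exact: P_evol.
- exact: bij_evol.
split=> n m nm; apply: opnorm_le => [|v].
- by rewrite mulr_ge0 ?expR_ge0.
- have -> : evol A n m (P m v) = green m v n.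
    rewrite PE /evol -(solves_steps (green_solves m v)).
      by congr green; lia.
    by move=> i _; rewrite /delta; case: eqP => //; lia.
  rewrite (le_trans (green_le _ _ _))// ger0_norm ?subr_ge0//.
  rewrite ler_wpM2r ?rnorm_ge0// ler_wpM2r ?expR_ge0//.
  by rewrite (le_trans _ (NM m))// lerDl.
- by rewrite mulr_ge0 ?expR_ge0.
- rewrite evol_backE// !fctE (le_trans (rnormB _ _))//.
  apply: (@le_trans _ _ ((N m + 1) * expR (- beta * (m - n)%:~R) * rnorm v)); last first.
    by rewrite ler_wpM2r ?rnorm_ge0// ler_wpM2r ?expR_ge0.
  rewrite addrC !mulrDl lerD//.
    by rewrite (le_trans (green_le _ _ _))// distrC ger0_norm ?subr_ge0.
  rewrite mul1r /delta; case: eqP => [->|_].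
    by rewrite subrr mulr0 expR0 mul1r.
  by rewrite rnorm0 mulr_ge0 ?expR_ge0 ?rnorm_ge0.
Qed.

End Dichotomy.

(** * Exponential weights *)

Lemma weight_gt0 (R : realType) (c e l : R) n : 0 < c -> 0 < weight c e l n.
Proof. by move=> c0; rewrite /weight !mulr_gt0// expR_gt0. Qed.

Section ExponentialResponse.
Variables (R : realType) (k : scalar_kind) (X : completeNormedModType (scalars R k)).
Variable A : int -> {linear X -> X}.

Lemma wball_delta (w : int -> R) m (v : X) :
  (forall n, 0 <= w n) -> wball w (w m * rnorm v) (delta m v).
Proof.
move=> w0 n; rewrite /delta; case: eqP => [->|_]//.
by rewrite rnorm0 mulr0 mulr_ge0// rnorm_ge0.
Qed.

Lemma admissible_delta (kappa eps lam : R) : (forall n, bounded_op (A n)) ->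
    0 < kappa ->
    properly_admissible A
      (linfty X (weight kappa eps lam)) (linfty X (weight 1 0 lam)) ->
  exists2 C, 0 < C & forall m v, exists2 x, solves A (delta m v) x &
    forall n, rnorm (x n) <=
      C * expR (eps * `|m|%:~R) * expR (lam * (n - m)%:~R) * rnorm v.
Proof.
move=> hA kappa0 adm.
have [||f Yf|C C0 CP] := admissible_bounded hA
    (w := weight kappa eps lam) (z := weight 1 0 lam).
- by move=> n; exact: weight_gt0.
- by move=> n; exact: weight_gt0.
- by have [x [[Zx sx] _]] := adm f Yf; exists x.
exists (C * kappa) => [|m v]; first exact: mulr_gt0.
have [v0|v0] := leP (rnorm v) 0.
  exists 0; last first.
    by move=> n; rewrite rnorm0 mulr_ge0 ?rnorm_ge0// !mulr_ge0 ?expR_ge0// ltW.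
  by rewrite (rnorm_le0 v0) => n; rewrite /delta if_same; exact: solves0.
have [||x sx xle] := CP (delta m v) (weight kappa eps lam m * rnorm v).
- by rewrite mulr_gt0 ?weight_gt0.
- by apply: wball_delta => n; exact/ltW/weight_gt0.
exists x => // n.
have := xle n; rewrite mulrC -ler_pdivlMr ?weight_gt0//; congr (_ <= _).
rewrite /weight mul1r mul0r expR0 mul1r -expRN -mulNr opprK.
have -> : lam * (n - m)%:~R = - lam * m%:~R + lam * n%:~R by rewrite rmorphB/=; ring.
rewrite expRD; ring.
Qed.

(** The two exponents [beta] and [- beta] give the same response to an impulse,
    because both responses grow at most like [expR (beta * |n|)]; its decay is
    governed by [- beta] after the impulse and by [beta] before it. *)
Lemma admissible_green (kappa eps beta : R) : (forall n, bounded_op (A n)) ->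
    0 < kappa -> 0 < beta ->
    properly_admissible A
     (linfty X (weight kappa eps beta)) (linfty X (weight 1 0 beta)) ->
    properly_admissible A
     (linfty X (weight kappa eps (- beta))) (linfty X (weight 1 0 (- beta))) ->
    (forall x, solves A 0 x -> linfty X (weight_abs 1 0 beta) x -> x = 0) ->
  exists2 C, 0 < C & forall m v, exists2 x, solves A (delta m v) x &
    forall n, rnorm (x n) <=
      C * expR (eps * `|m|%:~R) * expR (- beta * `|n - m|%:~R) * rnorm v.
Proof.
move=> hA kappa0 beta0 hpos hneg uniq.
have [C C0 CP] := admissible_delta hA kappa0 hpos.
have [D D0 DP] := admissible_delta hA kappa0 hneg.
exists (C + D) => [|m v]; first exact: addr_gt0.
have [x sx xle] := CP m v; have [y sy yle] := DP m v.
have wbound (lam B : R) (z : int -> X) : `|lam| <= beta -> 0 <= B ->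
    (forall n, rnorm (z n) <= B * expR (lam * (n - m)%:~R) * rnorm v) ->
    exists r, wball (weight_abs 1 0 beta) r z.
  move=> lamb B0 zle; exists (B * expR (- lam * m%:~R) * rnorm v) => n.
  have key : expR (- beta * `|n|%:~R) * expR (lam * (n - m)%:~R) <= expR (- lam * m%:~R).
    rewrite -expRD ler_expR rmorphB/= mulrBr.
    have : lam * n%:~R <= beta * `|n|%:~R.
      by rewrite (le_trans (ler_norm _))// normrM -intr_norm ler_wpM2r.
    lra.
  rewrite /weight_abs mul1r mul0r expR0 mul1r.
  rewrite (le_trans (ler_wpM2l (expR_ge0 _) (zle n)))//.
  by have := ler_wpM2l (mulr_ge0 B0 (rnorm_ge0 v)) key; congr (_ <= _); ring.
have xy : x = y.
  apply/eqP; rewrite -subr_eq0; apply/eqP/uniq.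
    by rewrite -[0](subrr (delta m v)); exact: solvesB.
  apply/linftyP.
  have [||r xr] := wbound beta _ x _ _ xle; first by rewrite gtr0_norm.
    by rewrite mulr_ge0 ?expR_ge0// ltW.
  have [||s ys] := wbound (- beta) _ y _ _ yle; first by rewrite normrN gtr0_norm.
    by rewrite mulr_ge0 ?expR_ge0// ltW.
  exists (r + s); apply: gaugeB xr ys; apply: gauge_wball => n.
  by rewrite /weight_abs !mulr_ge0 ?expR_ge0.
exists x => // n.
have mono (a b c : R) : a <= b ->
    a * expR (eps * `|m|%:~R) * expR c * rnorm v <=
    b * expR (eps * `|m|%:~R) * expR c * rnorm v.
  move=> ab; rewrite ler_wpM2r ?rnorm_ge0// ler_wpM2r ?expR_ge0//.
  by rewrite ler_wpM2r ?expR_ge0.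
have [mn|/ltW nm] := leP m n.
  by rewrite [`|n - m|]ger0_norm ?subr_ge0// xy (le_trans (yle n))// mono// lerDr ltW.
rewrite distrC [`|m - n|]ger0_norm ?subr_ge0// (le_trans (xle n))//.
rewrite (_ : - beta * _ = beta * (n - m)%:~R); last by rewrite !rmorphB/=; ring.
by rewrite mono// lerDl ltW.
Qed.

End ExponentialResponse.

Theorem corollary2 (R : realType) (k : scalar_kind)
  (X : completeNormedModType (scalars R k)) (hX : separable X)
  (A : int -> {linear X -> X}) (hA : forall n, bounded_op (A n))
  (kappa eps beta : R)
  (hkappa : 0 < kappa) (heps : 0 < eps) (hbeta : 0 < beta)
  (hpos : properly_admissible A
     (linfty X (weight kappa eps beta)) (linfty X (weight 1 0 beta)))
  (hneg : properly_admissible A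
     (linfty X (weight kappa eps (- beta))) (linfty X (weight 1 0 (- beta))))
  (habs : properly_admissible A
     (linfty X (weight_abs kappa eps beta)) (linfty X (weight_abs 1 0 beta))) :
  exists2 kappa' : R, 0 < kappa' &
    nonuniform_exp_dichotomy A (fun n => kappa' * expR (eps * `|n|%:~R)).
Proof.
have zeroY w : linfty X w 0.
  by apply/linftyP; exists 0 => n; rewrite rnorm0 mulr0.
have uniq x : solves A 0 x -> linfty X (weight_abs 1 0 beta) x -> x = 0.
  move=> sx Zx; have [y [_ yU]] := habs 0 (zeroY _).
  rewrite -(yU x); last by split.
  apply: yU; split; [exact: zeroY | exact: solves0].
have [C C0 green] := admissible_green hA hkappa hbeta hpos hneg uniq.
exists (C + 1); first by rewrite addr_gt0.
apply: (green_dichotomy hbeta _ _ green) => [m|x sx [c xc]|m].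
- by rewrite mulr_ge0 ?expR_ge0// ltW.
- apply: uniq => //; apply/linftyP; exists c => n.
  rewrite (le_trans _ (xc n))// ler_piMl ?rnorm_ge0//.
  rewrite /weight_abs mul0r expR0 !mul1r -expR0 ler_expR mulNr oppr_le0.
  by rewrite mulr_ge0 ?ler0z// ltW.
- rewrite mulrDl lerD2l mul1r -expR0 ler_expR.
  by rewrite mulr_ge0 ?ler0z// ltW.
Qed.
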